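(* Let $\rho_0=|\psi_0\rangle\langle\psi_0|$ be a pure state ($\psi_0$ a unit vector) and $\rho_1$ a state on a finite-dimensional complex Hilbert space $H$, each having prior probability $1/2$. Then there is a test (one for each sample size $N$) which uses separable independent measurements of the $N$ copies with two outcomes in each measurement, and which is asymptotically optimal; its average error probability $R_N$ satisfies $$R_N\lesssim\frac12\langle\psi_0|\rho_1|\psi_0\rangle^N\quad\text{as }N\to\infty.$$ Here asymptotically optimal means that its exponential error rate equals that of the optimal joint measurement: $$\lim_{N\to\infty}\frac1N\log R_N=\lim_{N\to\infty}\frac1N\log R_N^{\mathrm{joint}}$$ (with $\log 0=-\infty$).
   Context: A state on a finite-dimensional complex Hilbert space $H$ is a positive semidefinite operator of trace $1$; it is pure if it has rank one. A measurement on a Hilbert space is a finite family $\{M_i\}$ of positive semidefinite operators summing to the identity; when applied to a state $\rho$, outcome $i$ occurs with probability $\operatorname{tr}(M_i\rho)$. One is given $N$ identical copies of a state which is either $\rho_0$ or $\rho_1$, each with prior probability $1/2$. A test with separable independent measurements applies a measurement on $H$ to each copy separately, independently of the results on the other copies, and then applies a decision rule to the $N$ observed outcomes, choosing $\rho_0$ or $\rho_1$. The average error probability of a test is $\frac12 \Pr(\text{choose }\rho_1\mid\rho_0)+\frac12\Pr(\text{choose }\rho_0\mid\rho_1)$. $R_N^{\mathrm{joint}}$ is the minimum of the average error probability over all tests that apply an arbitrary measurement on $H^{\otimes N}$ to the joint state $\rho_0^{\otimes N}$ or $\rho_1^{\otimes N}$ followed by a decision rule. The notation $a_N\lesssim b_N$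 means $a_N\le b_N(1+o(1))$ as $N\to\infty$. *)

(* Defs.v *)
From HB Require Import structures.
From mathcomp Require Import all_boot all_order all_algebra.
From mathcomp Require Import all_classical all_reals all_analysis.
From mathcomp Require Import complex.
From mathcomp Require mxtens.

Set Implicit Arguments.
Unset Strict Implicit.
Unset Printing Implicit Defensive.

Import Order.TTheory GRing.Theory Num.Theory.
Import numFieldNormedType.Exports.

Local Open Scope classical_set_scope.
Local Open Scope ring_scope.
Local Open Scope complex_scope.
Local Open Scope sesquilinear_scope.

(* The Hilbert space H is C^n with its standard inner product: kets are column
   vectors, operators are square matrices over R[i], the adjoint of A is A^t*.
   H^{\otimes N} is C^(n^N), with Kronecker powers of operators. *)

Section Operators.
Variables (R : realType) (n : nat).
Implicit Types (A rho : 'M[R[i]]_n) (psi : 'cV[R[i]]_n).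

(* On R[i], 0 <= z says that z is real and nonnegative. *)
Definition psd A : Prop :=
  A \is hermsymmx /\ forall v : 'cV[R[i]]_n, 0 <= (v^t* *m A *m v) 0 0.

Definition is_state rho : Prop := psd rho /\ \tr rho = 1.

Definition unit_vector psi : Prop := (psi^t* *m psi) 0 0 = 1.

(* |psi><psi| *)
Definition pure_state psi : 'M[R[i]]_n := psi *m psi^t*.

(* <psi|A|psi>; this is a real number when A is Hermitian *)
Definition expval psi A : R := complex.Re ((psi^t* *m A *m psi) 0 0).

End Operators.

Record measurement (R : realType) (n k : nat) := Measurement {
  povm :> 'I_k -> 'M[R[i]]_n;
  povm_psd : forall i, psd (povm i);
  povm_sum : \sum_i povm i = 1%:M
}.

(* The trace of a product of two positive semidefinite operators is real. *)
Definition outcome_prob (R : realType) (n k : nat) (M : measurement R n k)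
    (rho : 'M[R[i]]_n) (i : 'I_k) : R :=
  complex.Re (\tr (M i *m rho)).

(* Data x is distributed according to p0 (resp. p1) under the hypothesis rho_0
   (resp. rho_1); the decision rule d chooses rho_1 on x when d x is true, and
   rho_0 otherwise. *)
Definition avg_error (R : realType) (X : finType) (p0 p1 : X -> R)
    (d : X -> bool) : R :=
  2^-1 * (\sum_(x | d x) p0 x) + 2^-1 * (\sum_(x | ~~ d x) p1 x).

(* The measurement may differ from copy to copy but is fixed in advance; all
   measurements have k outcomes. *)
Record sep_test (R : realType) (n k N : nat) := SepTest {
  sep_meas : 'I_N -> measurement R n k;
  sep_rule : {ffun 'I_N -> 'I_k} -> bool
}.

Definition sep_prob (R : realType) (n k N : nat) (T : sep_test R n k N)
    (rho : 'M[R[i]]_n) (x : {ffun 'I_N -> 'I_k}) : R :=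
  \prod_(j < N) outcome_prob (sep_meas T j) rho (x j).

Definition sep_error (R : realType) (n k N : nat) (T : sep_test R n k N)
    (rho0 rho1 : 'M[R[i]]_n) : R :=
  avg_error (sep_prob T rho0) (sep_prob T rho1) (sep_rule T).

(* The number of outcomes of a joint measurement is arbitrary. *)
Record joint_test (R : realType) (n N : nat) := JointTest {
  joint_outcomes : nat;
  joint_meas : measurement R (n ^ N) joint_outcomes;
  joint_rule : 'I_joint_outcomes -> bool
}.

Definition joint_error (R : realType) (n N : nat) (T : joint_test R n N)
    (rho0 rho1 : 'M[R[i]]_n) : R :=
  avg_error (outcome_prob (joint_meas T) (mxtens.ntensmx rho0 N))
            (outcome_prob (joint_meas T) (mxtens.ntensmx rho1 N))
            (@joint_rule _ _ _ T).

(* For states rho0 and rho1 this infimum is a minimum: by merging outcomes the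
   error is that of a two-outcome measurement, a continuous function on a
   compact set. *)
Definition joint_opt_error (R : realType) (n : nat) (rho0 rho1 : 'M[R[i]]_n)
    (N : nat) : R :=
  inf [set joint_error T rho0 rho1 | T in [set: joint_test R n N]].

(* a_N <= b_N (1 + o(1)) as N -> oo *)
Definition asymp_le (R : realType) (a b : R^nat) : Prop :=
  exists2 e : R^nat, e @ \oo --> (0 : R) &
    \forall N \near \oo, a N <= b N * (1 + e N).

(* (1/N) log a_N in the extended reals, with lne 0 = -oo; the junk value at
   N = 0 plays no role in the limit. *)
Definition log_rate (R : realType) (a : R^nat) (N : nat) : \bar R :=
  (N%:R^-1%:E * lne (a N)%:E)%E.

Definition same_exp_rate (R : realType) (a b : R^nat) : Prop :=
  exists l : \bar R, log_rate a @ \oo --> l /\ log_rate b @ \oo --> l.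

(* Main.v *)
(* The test measures {P, 1 - P} with P = |psi0><psi0| on every copy and chooses
   rho0 iff every outcome is P: it never errs under rho0, and errs under rho1
   with probability F^N, where F = <psi0|rho1|psi0>. Conversely, for states
   rho, sigma and a resolution of the identity E + E' = 1, inserting E + E'
   between square roots of rho and sigma and using submultiplicativity of the
   Frobenius norm gives tr(rho sigma) <= 2 (tr(E rho) + tr(E' sigma)). Applied to
   the tensor powers, where the left-hand side is F^N, this bounds the error of
   every joint test below by F^N / 4, so both error rates are log F. *)

Require Import Defs.
From mathcomp Require Import all_boot all_order all_algebra.
From mathcomp Require Import all_classical all_reals all_analysis.
From mathcomp Require Import complex.
From mathcomp Require Import ring lra.
From mathcomp Require mxtens.

Set Implicit Arguments.
Unset Strict Implicit.
Unset Printing Implicit Defensive.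

Import Order.TTheory GRing.Theory Num.Theory.
Import numFieldNormedType.Exports.

Local Open Scope classical_set_scope.
Local Open Scope ring_scope.
Local Open Scope complex_scope.
Local Open Scope sesquilinear_scope.

(** * Frobenius norms and Gram factorizations of complex matrices *)

Section Frobenius.
Variable C : numClosedFieldType.

Lemma trmxC_mul m n p (A : 'M[C]_(m, n)) (B : 'M[C]_(n, p)) :
  (A *m B)^t* = B^t* *m A^t*.
Proof. by rewrite trmx_mul map_mxM. Qed.

Lemma trmxCB m n (A B : 'M[C]_(m, n)) : (A - B)^t* = A^t* - B^t*.
Proof. by apply/matrixP => i j; rewrite !mxE rmorphB. Qed.

Lemma trmxC1 n : (1%:M : 'M[C]_n)^t* = 1%:M.
Proof. by rewrite trmx1 map_mx1. Qed.

(** The square of the Frobenius norm, which avoids square roots of norms throughout. *)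
Definition frob m n (A : 'M[C]_(m, n)) : C := \tr (A *m A^t*).

Lemma frob_sum m n (A : 'M[C]_(m, n)) :
  frob A = \sum_i \sum_j `|A i j| ^+ 2.
Proof.
by apply: eq_bigr => i _; rewrite mxE; apply: eq_bigr => j _; rewrite !mxE normCK.
Qed.

Lemma frob_ge0 m n (A : 'M[C]_(m, n)) : 0 <= frob A.
Proof.
by rewrite frob_sum; do 2!apply: sumr_ge0 => ? _; rewrite exprn_ge0.
Qed.

Lemma frob_trmxC m n (A : 'M[C]_(m, n)) : frob (A^t* ) = frob A.
Proof. by rewrite /frob trmxCK mxtrace_mulC. Qed.

(** Entrywise, [2 * (a ^+ 2 + b ^+ 2) - (a + b) ^+ 2] is the square [(a - b) ^+ 2]. *)
Lemma frobD_le m n (A B : 'M[C]_(m, n)) :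
  frob (A + B) <= 2 * (frob A + frob B).
Proof.
rewrite !frob_sum -big_split mulr_sumr; apply: ler_sum => i _ /=.
rewrite -big_split mulr_sumr; apply: ler_sum => j _ /=; rewrite mxE.
rewrite (@le_trans _ _ ((`|A i j| + `|B i j|) ^+ 2)) //.
  by rewrite ler_pXn2r ?nnegrE ?addr_ge0 ?ler_normD.
rewrite -subr_ge0.
have -> : 2 * (`|A i j| ^+ 2 + `|B i j| ^+ 2) - (`|A i j| + `|B i j|) ^+ 2
  = (`|A i j| - `|B i j|) ^+ 2 by rewrite sqrrD sqrrB mulr2n mulrDl mul1r; ring.
by rewrite real_exprn_even_ge0 // rpredB // normr_real.
Qed.

(** Each entry of the product is an inner product of a row of [A] with a row of [B^t*], so
    Cauchy-Schwarz applies entry by entry. *)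
Lemma frobM_le m n p (A : 'M[C]_(m, n)) (B : 'M[C]_(n, p)) :
  frob (A *m B) <= frob A * frob B.
Proof.
rewrite -(frob_trmxC B) !frob_sum mulr_suml; apply: ler_sum => i _.
rewrite mulr_sumr; apply: ler_sum => j _.
have normE k (u : 'rV[C]_k) : dotmx u u = \sum_l `|u 0 l| ^+ 2.
  by rewrite dotmxE mxE; apply: eq_bigr => l _; rewrite !mxE normCK.
have : `|dotmx (row i A) (row j (B^t* ))| ^+ 2
    <= dotmx (row i A) (row i A) * dotmx (row j (B^t* )) (row j (B^t* )).
  exact: (CauchySchwarz (@dotmx C n) _ _).1.
rewrite !normE dotmxE !mxE.
under eq_bigr do rewrite !mxE conjCK.
under [X in _ <= X * _ -> _]eq_bigr do rewrite !mxE.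
by under [X in _ <= _ * X -> _]eq_bigr do rewrite mxE.
Qed.

(** Each summand splits at its middle Gram product, as in [(W^t* *m B) *m (B^t* *m A)];
    submultiplicativity applies, and the factor assumed at most 1 is dropped. *)
Lemma frob_resolution_le m n p q r (W : 'M[C]_(n, m)) (A : 'M[C]_(n, p))
    (B : 'M[C]_(n, q)) (B' : 'M[C]_(n, r)) :
  frob (B^t* *m A) <= 1 -> frob (B'^t* *m W) <= 1 ->
  frob (W^t* *m (B *m B^t* ) *m A + W^t* *m (B' *m B'^t* ) *m A)
    <= 2 * (frob (B^t* *m W) + frob (B'^t* *m A)).
Proof.
move=> BA_le1 B'W_le1; apply: le_trans (frobD_le _ _) _.
apply: ler_wpM2l => //; rewrite !mulmxA -!(mulmxA _ _ A).
apply: lerD; apply: le_trans (frobM_le _ _) _.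
  rewrite -(frob_trmxC (_ *m B)) trmxC_mul trmxCK.
  by apply: ler_piMr => //; apply: frob_ge0.
rewrite -(frob_trmxC (_ *m B')) trmxC_mul trmxCK.
by apply: ler_piMl => //; apply: frob_ge0.
Qed.

(** Cyclicity of the trace; overlaps of positive semidefinite operators thus become squared
    norms. *)
Lemma mxtrace_gram m n p (X : 'M[C]_(m, n)) (Y : 'M[C]_(m, p)) :
  \tr (X *m X^t* *m (Y *m Y^t* )) = frob (X^t* *m Y).
Proof. by rewrite /frob trmxC_mul trmxCK -mulmxA mxtrace_mulC !mulmxA. Qed.

(** By the spectral theorem [A = P^t* *m diag_mx d *m P] with [P] unitary; take
    [B = P^t* *m diag_mx s], where [s] is the entrywise square root of [d]. *)
Lemma gram_exists n (A : 'M[C]_n) : A \is hermsymmx ->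
  (forall v : 'cV[C]_n, 0 <= (v^t* *m A *m v) 0 0) ->
  exists B : 'M[C]_n, A = B *m B^t*.
Proof.
move=> hA A_ge0; have /orthomx_spectralP := hermitian_normalmx hA.
set P := spectralmx A; set d := spectral_diag A => AE.
have uP : P \is unitarymx := spectral_unitarymx A.
rewrite invmx_unitary // in AE.
have d_ge0 i : 0 <= d 0 i.
  (* The quadratic form at the [i]-th eigenvector is the eigenvalue [d 0 i]. *)
  have := A_ge0 (P^t* *m delta_mx i 0).
  rewrite AE trmxC_mul trmxCK !mulmxA (mulmxtVK _ uP).
  rewrite -[_ *m P *m _]mulmxA (unitarymxP uP) mulmx1.
  by rewrite trmx_delta map_delta_mx -rowE -colE !mxE eqxx mulr1n.
pose s : 'rV[C]_n := \row_i sqrtC (d 0 i).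
exists (P^t* *m diag_mx s); rewrite trmxC_mul trmxCK mulmxA.
rewrite -[_ *m diag_mx s *m _]mulmxA tr_diag_mx map_diag_mx mulmx_diag {1}AE.
congr (_ *m diag_mx _ *m _); apply/rowP => i; rewrite !mxE.
by rewrite [X in _ * X]geC0_conj ?sqrtC_ge0 -?expr2 ?sqrtCK.
Qed.

End Frobenius.

(** * Positive semidefinite operators and the overlap of two states *)

Section PositiveSemidefinite.
Variables (R : realType).
Local Notation C := R[i].

Lemma hermsymmxP n (A : 'M[C]_n) : reflect (A^t* = A) (A \is hermsymmx).
Proof.
apply: (iffP (is_hermitianmxP _ _ _)) => [{2}->|AE]; last first.
  by rewrite -[in LHS]AE expr0 scale1r.
by rewrite expr0 scale1r.
Qed.

Lemma psd_gram m n (B : 'M[C]_(m, n)) : psd (B *m B^t*).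
Proof.
split; first by apply/hermsymmxP; rewrite trmxC_mul trmxCK.
move=> v; rewrite mulmxA -mulmxA -[X in _ *m X]trmxCK trmxC_mul trmxCK.
by rewrite -trace_mx11; apply: frob_ge0.
Qed.

Lemma psd_sum n (I : finType) (P : pred I) (M : I -> 'M[C]_n) :
  (forall i, psd (M i)) -> psd (\sum_(i | P i) M i).
Proof.
move=> psdM; split.
  apply/hermsymmxP; rewrite raddf_sum map_mx_sum; apply: eq_bigr => i _.
  by apply/hermsymmxP; case: (psdM i).
move=> v; rewrite mulmx_sumr mulmx_suml summxE; apply: sumr_ge0 => i _.
by case: (psdM i).
Qed.

Lemma psdP n (A : 'M[C]_n) : psd A -> exists B : 'M[C]_n, A = B *m B^t*.
Proof. by case=> hA /(gram_exists hA). Qed.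

Lemma psd_mxtrace_mul_ge0 n (A B : 'M[C]_n) : psd A -> psd B -> 0 <= \tr (A *m B).
Proof. by move=> /psdP[X ->] /psdP[Y ->]; rewrite mxtrace_gram frob_ge0. Qed.

Lemma state_overlap_le n (E E' rho sigma : 'M[C]_n) :
  psd E -> psd E' -> E + E' = 1%:M -> is_state rho -> is_state sigma ->
  \tr (rho *m sigma) <= 2 * (\tr (E *m rho) + \tr (E' *m sigma)).
Proof.
move=> psdE psdE' E1 [psdrho trrho] [psdsigma trsigma].
(* Since [F + F'] is the identity, the traces of [F *m tau] and [F' *m tau] are nonnegative numbers
   with sum 1. This provides the two bounds by 1 in [frob_resolution_le]. *)
have le1 (F F' tau : 'M[C]_n) : psd F -> psd F' -> F + F' = 1%:M -> psd tau ->
    \tr tau = 1 -> \tr (F *m tau) <= 1.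
  move=> psdF psdF' F1 psdtau <-.
  rewrite -[tau in leRHS]mul1mx -F1 mulmxDl mxtraceD lerDl.
  exact: psd_mxtrace_mul_ge0.
have Erho_ge0 := psd_mxtrace_mul_ge0 psdE psdrho.
have E'sigma_ge0 := psd_mxtrace_mul_ge0 psdE' psdsigma.
have := le1 _ _ _ psdE psdE' E1 psdsigma trsigma.
have := le1 _ _ _ psdE' psdE (etrans (addrC _ _) E1) psdrho trrho.
have [B EE] := psdP psdE; have [B' EE'] := psdP psdE'.
have [W rhoE] := psdP psdrho; have [A sigmaE] := psdP psdsigma.
move: Erho_ge0 E'sigma_ge0.
have -> : \tr (rho *m sigma)
    = frob (W^t* *m (B *m B^t* ) *m A + W^t* *m (B' *m B'^t* ) *m A).
  by rewrite -mulmxDl -mulmxDr -EE -EE' E1 mulmx1 rhoE sigmaE mxtrace_gram.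
rewrite EE EE' rhoE sigmaE !mxtrace_gram => Erho_ge0 E'sigma_ge0 E'rho_le1 Esigma_le1.
exact: frob_resolution_le.
Qed.

End PositiveSemidefinite.

(** * Compatibility of Kronecker powers with trace, product and adjoint *)

Section TensorPowers.
Variable C : numClosedFieldType.
Import mxtens.

Lemma mxtrace_tensmx m n (A : 'M[C]_m) (B : 'M[C]_n) :
  \tr (tensmx A B) = \tr A * \tr B.
Proof. by rewrite /mxtrace mulr_sum; apply: eq_bigr => i _; rewrite !mxE. Qed.

Lemma mxtrace_ntensmx n (A : 'M[C]_n) N : \tr (ntensmx A N) = \tr A ^+ N.
Proof.
(* The recursion [ntensmxSS] starts at the first power, so the zeroth power is treated apart. *)
case: N => [|N]; first by rewrite ntensmx0 expr0 mxtrace1.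
elim: N => [|N IHN]; first by rewrite ntensmx1 expr1.
by rewrite ntensmxSS mxtrace_tensmx IHN -exprS.
Qed.

Lemma ntensmx_mul n (A B : 'M[C]_n) N :
  ntensmx (A *m B) N = ntensmx A N *m ntensmx B N.
Proof.
case: N => [|N]; first by rewrite !ntensmx0 mulmx1.
by elim: N => [|N IHN] //; rewrite !ntensmxSS IHN tensmx_mul.
Qed.

Lemma ntensmx_trmxC n (A : 'M[C]_n) N : ntensmx (A^t* ) N = (ntensmx A N)^t*.
Proof.
case: N => [|N]; first by rewrite !ntensmx0 trmxC1.
by elim: N => [|N IHN] //; rewrite !ntensmxSS IHN trmx_tens map_mxT.
Qed.

End TensorPowers.

(** * Projective measurements and the lower bound for joint tests *)

Section Errors.
Variable R : realType.
Local Notation C := R[i].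

Lemma is_state_ntensmx n (rho : 'M[C]_n) N :
  is_state rho -> is_state (mxtens.ntensmx rho N).
Proof.
case=> /psdP[B ->] tr1; split; last by rewrite mxtrace_ntensmx tr1 expr1n.
by rewrite ntensmx_mul ntensmx_trmxC; apply: psd_gram.
Qed.

Lemma psd_projector n (P : 'M[C]_n) : P^t* = P -> P *m P = P -> psd P.
Proof. by move=> PC PP; rewrite -PP -{2}PC; apply: psd_gram. Qed.

Definition proj_povm n (P : 'M[C]_n) (i : 'I_2) : 'M[C]_n :=
  if i == ord0 then P else 1%:M - P.

Lemma proj_povm_psd n (P : 'M[C]_n) :
  P^t* = P -> P *m P = P -> forall i, psd (proj_povm P i).
Proof.
move=> PC PP i; rewrite /proj_povm; case: ifP => _; apply: psd_projector => //.
  by rewrite trmxCB trmxC1 PC.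
by rewrite mulmxBl mul1mx mulmxBr mulmx1 PP subrr subr0.
Qed.

Lemma proj_povm_sum n (P : 'M[C]_n) : \sum_i proj_povm P i = 1%:M.
Proof. by rewrite big_ord_recl big_ord1 /proj_povm /= addrC subrK. Qed.

Definition proj_measurement n (P : 'M[C]_n) (PC : P^t* = P) (PP : P *m P = P) :
  measurement R n 2 := Measurement (proj_povm_psd PC PP) (proj_povm_sum P).

(** Linearity of trace and real part; it merges all outcomes leading to one decision into a single
    operator. *)
Lemma sum_outcome_prob n k (M : measurement R n k) (rho : 'M[C]_n) (P : pred 'I_k) :
  \sum_(i | P i) outcome_prob M rho i = complex.Re (\tr ((\sum_(i | P i) M i) *m rho)).
Proof.
rewrite mulmx_suml (big_morph _ (@mxtraceD _ n) (mxtrace0 _ n)).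
exact: (esym (raddf_sum (@complex.Re R) _ _ _)).
Qed.

(** The merged operators for the two decisions resolve the identity, so [state_overlap_le] applies
    to the tensor powers. Its factor 2 and the prior 1/2 give the constant 1/4. *)
Lemma joint_error_ge n N (T : joint_test R n N) (rho0 rho1 : 'M[C]_n) :
  is_state rho0 -> is_state rho1 ->
  4^-1 * complex.Re (\tr (rho0 *m rho1) ^+ N) <= joint_error T rho0 rho1.
Proof.
move=> /(@is_state_ntensmx _ _ N) st0 /(@is_state_ntensmx _ _ N) st1.
case: T => k M d; rewrite /joint_error /avg_error /= !sum_outcome_prob.
have psdM Q : psd (\sum_(i | Q i) M i) by apply: psd_sum => i; apply: povm_psd.
have M1 : \sum_(i | d i) M i + \sum_(i | ~~ d i) M i = 1%:M.
  by rewrite -(povm_sum M) [RHS](bigID d).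
have := state_overlap_le (psdM d) (psdM (predC d)) M1 st0 st1.
(* The order on [R[i]] compares real parts and requires equal imaginary parts; only the real
   comparison is kept. *)
rewrite -ntensmx_mul mxtrace_ntensmx lecE => /andP[_].
set x := \tr (_ *m _); set y := \tr (_ *m _) => le_xy.
have {le_xy} : complex.Re (\tr (rho0 *m rho1) ^+ N) <= 2 * (complex.Re x + complex.Re y).
  by rewrite (le_trans le_xy) // mulr_natl mulr2n !raddfD /=; lra.
lra.
Qed.
End Errors.

(** * The projective test for a pure state, and bounds on the optimal joint error *)

Section PureState.
Variables (R : realType) (n : nat) (psi : 'cV[R[i]]_n).
Local Notation C := R[i].
Local Notation P := (pure_state psi).

Lemma pure_state_trmxC : P^t* = P.
Proof. by rewrite trmxC_mul trmxCK. Qed.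

Lemma mxtrace_pure_state_mul (A : 'M[C]_n) :
  \tr (P *m A) = (psi^t* *m A *m psi) 0 0.
Proof. by rewrite /pure_state -mulmxA mxtrace_mulC trace_mx11. Qed.

(** A nonnegative element of [R[i]] has zero imaginary part, so taking the real part in [expval]
    loses nothing. *)
Lemma psd_expval (A : 'M[C]_n) : psd A ->
  0 <= expval psi A /\ \tr (P *m A) = (expval psi A)%:C.
Proof.
move=> [_ /(_ psi) A_ge0]; rewrite mxtrace_pure_state_mul.
by move: A_ge0; rewrite lecE /= => /andP[/eqP im re]; split=> //;
  rewrite [LHS]complexE im mulr0 addr0.
Qed.

Hypothesis unit_psi : unit_vector psi.

Lemma pure_state_idem : P *m P = P.
Proof.
rewrite /pure_state mulmxA -(mulmxA psi) [psi^t* *m psi]mx11_scalar.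
by move: unit_psi; rewrite /unit_vector => ->; rewrite mulmx1.
Qed.

Lemma is_state_pure_state : is_state P.
Proof.
split; first exact: psd_gram.
by rewrite /pure_state mxtrace_mulC trace_mx11.
Qed.

Definition sep_proj_test N : sep_test R n 2 N :=
  SepTest (fun=> proj_measurement pure_state_trmxC pure_state_idem)
    (fun x : {ffun 'I_N -> 'I_2} => [exists j, x j != ord0]).

Lemma sep_proj_test_error N (rho : 'M[C]_n) :
  sep_error (sep_proj_test N) P rho = 2^-1 * expval psi rho ^+ N.
Proof.
(* Under the pure state, data rejecting it contains an outcome of probability
   [\tr ((1 - P) *m P) = 0]. *)
rewrite /sep_error /avg_error big1 => [|x /existsP[j xj]]; last first.
  rewrite /sep_prob (bigD1 j) //= /outcome_prob /= /proj_povm (negbTE xj).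
  by rewrite mulmxBl mul1mx pure_state_idem subrr mxtrace0 mul0r.
(* Only the constant string [ord0] leads to accepting the pure state. *)
rewrite mulr0 add0r (big_pred1 [ffun=> ord0]) => [|x]; last first.
  apply/existsPn/eqP => [x0|-> j]; last by rewrite ffunE eqxx.
  by apply/ffunP => j; rewrite ffunE; apply/eqP; rewrite -[_ == _]negbK x0.
congr (_ * _); rewrite -[N in RHS]card_ord -prodr_const; apply: eq_bigr => j _.
by rewrite ffunE /outcome_prob /= /proj_povm eqxx mxtrace_pure_state_mul.
Qed.

Lemma joint_opt_error_bounds (rho : 'M[C]_n) N : is_state rho ->
  4^-1 * expval psi rho ^+ N <= joint_opt_error P rho N <= 2^-1 * expval psi rho ^+ N.
Proof.
move=> st_rho; have [F_ge0 trF] := psd_expval st_rho.1.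
have ReF : complex.Re (\tr (P *m rho) ^+ N) = expval psi rho ^+ N.
  by rewrite trF -rmorphXn.
pose PN := mxtens.ntensmx P N.
have PNC : PN^t* = PN by rewrite -ntensmx_trmxC pure_state_trmxC.
have PNP : PN *m PN = PN by rewrite -ntensmx_mul pure_state_idem.
(* The upper bound is attained by projecting onto the tensor power of the pure state. *)
pose T := @JointTest R n N 2 (proj_measurement PNC PNP) (fun i => i != ord0).
have T_error : joint_error T P rho = 2^-1 * expval psi rho ^+ N.
  rewrite /joint_error /avg_error big_mkcond big_ord_recl big_ord1 /= add0r.
  rewrite big_mkcond big_ord_recl big_ord1 /= addr0 /outcome_prob /= /proj_povm /=.
  rewrite mulmxBl mul1mx PNP subrr mxtrace0 mulr0 add0r.
  by rewrite -ntensmx_mul mxtrace_ntensmx ReF.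
(* This gives the left inequality and also the lower boundedness that [ge_inf] requires. *)
have lb : lbound [set joint_error T P rho | T in [set: joint_test R n N]]
    (4^-1 * expval psi rho ^+ N).
  by move=> _ [T' _ <-]; rewrite -ReF joint_error_ge //; apply: is_state_pure_state.
apply/andP; split.
  by apply: lb_le_inf => //; exists (joint_error T P rho); exists T.
by rewrite -T_error; apply: ge_inf; [exists (4^-1 * expval psi rho ^+ N)|exists T].
Qed.

End PureState.

(** * Exponential rates of sequences comparable to a geometric one *)

Section Rates.
Variable R : realType.

(** For positive [N] the rate equals [N%:R^-1 * ln c + ln F], whose first term vanishes in the
    limit. *)
Lemma log_rate_geometric (c F : R) : 0 < c -> 0 < F ->
  log_rate (fun N => c * F ^+ N) @ \oo --> (ln F)%:E.
Proof.
move=> c_gt0 F_gt0; apply/cvg_EFin.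
  by near=> N; rewrite /log_rate lne_EFin ?mulr_gt0 ?exprn_gt0.
have : (fun N : nat => N%:R^-1 * ln c + ln F) @ \oo --> 0 * ln c + ln F.
  apply: cvgD; last exact: cvg_cst.
  apply: cvgMl; apply/gtr0_cvgV0; last exact: cvgr_idn.
  by near=> N; rewrite ltr0n; near: N; apply: nbhs_infty_gt.
rewrite mul0r add0r; apply: cvg_trans; apply: near_eq_cvg; near=> N.
have N_gt0 : (0 < N)%N by near: N; apply: nbhs_infty_gt.
rewrite /= /log_rate lne_EFin ?mulr_gt0 ?exprn_gt0 //=.
rewrite lnM ?posrE ?exprn_gt0 // lnXn // mulrDr -[ln F *+ N]mulr_natl mulKf //.
by rewrite pnatr_eq0 -lt0n.
Unshelve. all: by end_near. Qed.

Lemma log_rate_sandwich (a : R^nat) (c c' F : R) : 0 < c -> 0 <= F ->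
  (forall N, c * F ^+ N <= a N <= c' * F ^+ N) ->
  log_rate a @ \oo --> lne F%:E.
Proof.
move=> c_gt0 F_ge0 aP; have [F_gt0|] := ltrP 0 F; last first.
  (* If [F = 0], both bounds vanish for positive [N] and the rate is constantly minus infinity;
     [N = 0] is excluded because [0 ^+ 0 = 1]. *)
  move=> F_le0; have F0 : F = 0 by apply/eqP; rewrite eq_le F_le0.
  rewrite le0_lneNy ?lee_fin //; apply: cvg_near_cst; near=> N.
  have N_gt0 : (0 < N)%N by near: N; apply: nbhs_infty_gt.
  have := aP N; rewrite F0 expr0n gtn_eqF // !mulr0 => /andP[a_ge0 a_le0].
  by rewrite /log_rate le0_lneNy ?lee_fin // gt0_muleNy // lte_fin invr_gt0 ltr0n.
have c'_gt0 : 0 < c'.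
  (* At [N = 0] the bounds read [c <= a 0 <= c']. *)
  have /andP[ca ac'] := aP 0; apply: lt_le_trans c_gt0 _.
  by have := le_trans ca ac'; rewrite !expr0 !mulr1.
rewrite lne_EFin //.
apply: (@squeeze_cvge _ _ _ _ (log_rate (fun N => c * F ^+ N)) _
  (log_rate (fun N => c' * F ^+ N))); try exact: log_rate_geometric.
near=> N; have /andP[ca ac'] := aP N.
have cF_gt0 : 0 < c * F ^+ N by rewrite mulr_gt0 ?exprn_gt0.
have a_gt0 := lt_le_trans cF_gt0 ca; have c'F_gt0 := lt_le_trans a_gt0 ac'.
by rewrite /log_rate !lne_EFin // !lee_fin !ler_wpM2l ?ler_ln ?invr_ge0.
Unshelve. all: by end_near. Qed.

End Rates.

Theorem theorem5p2 (R : realType) (n : nat)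
    (psi0 : 'cV[R[i]]_n) (rho1 : 'M[R[i]]_n)
    (hpsi0 : unit_vector psi0) (hrho1 : is_state rho1) :
  exists T : forall N : nat, sep_test R n 2 N,
    asymp_le (fun N => sep_error (T N) (pure_state psi0) rho1)
             (fun N => 2^-1 * expval psi0 rho1 ^+ N) /\
    same_exp_rate (fun N => sep_error (T N) (pure_state psi0) rho1)
                  (joint_opt_error (pure_state psi0) rho1).
Proof.
have [F_ge0 _] := psd_expval psi0 hrho1.1.
exists (sep_proj_test hpsi0); split.
  (* The error equals the bound exactly, so the relative correction is zero. *)
  exists (fun=> 0); first exact: cvg_cst.
  by apply: nearW => N; rewrite sep_proj_test_error addr0 mulr1.
(* The common rate is the logarithm of the overlap, minus infinity when the overlap is zero. *)
exists (lne (expval psi0 rho1)%:E); split.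
  apply: (@log_rate_sandwich _ _ 2^-1 2^-1) => // N.
  by rewrite sep_proj_test_error lexx.
apply: (@log_rate_sandwich _ _ 4^-1 2^-1) => // N.
exact: joint_opt_error_bounds.
Qed.
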